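(* Let $\beta>0$ and let $G$ be an $(n,\beta)$-graph on $n$ vertices. Then $$\alpha'(G)\ge \min\left\{\frac{2-\beta}{2(1+\beta)},\ \frac{1}{2}\right\}\cdot (n-1).$$ In particular, if $n$ is even and $0<\beta\le 1/2$, then $G$ has a perfect matching.
   Context: All graphs are finite, simple and nonempty. $\alpha'(G)$ denotes the matching number. For vertex sets $X,Y$, $e(X,Y)$ is the number of edges with one end in $X$ and the other in $Y$ (edges with both ends in $X\cap Y$ counted twice). For $\beta>0$, a graph $G$ on $n$ vertices is an $(n,\beta)$-graph if $\frac{|X||Y|}{(n-|X|)(n-|Y|)}\le\beta^2$ for every pair of (not necessarily disjoint) proper subsets $X,Y$ of $V(G)$ with $e(X,Y)=0$. By convention the complete graph $K_n$ is an $(n,\beta)$-graph for every $\beta>0$.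
   Formalization: The graph with two vertices and no edge is excluded: it is a (2,β)-graph for every β ≥ 1 with matching number 0, so the stated bound fails for it when 1 ≤ β < 2 (for β ≥ 2 the bound there is trivial). *)

(* Defs.v *)
From mathcomp Require Import all_boot all_order all_algebra.
From mathcomp Require Import reals.

Set Implicit Arguments.
Unset Strict Implicit.
Unset Printing Implicit Defensive.

Import Order.TTheory GRing.Theory Num.Theory.

Local Open Scope ring_scope.

(* A finite simple graph on the vertex set T is given by an adjacency relation
   e : rel T; the hypotheses symmetric e and irreflexive e are kept explicit
   in the statements that use these definitions. *)

Definition edge_set (T : finType) (e : rel T) : {set {set T}} :=
  [set [set p.1; p.2] | p : T * T & e p.1 p.2].

Definition is_matching (T : finType) (e : rel T) (M : {set {set T}}) : bool :=
  (M \subset edge_set e) && trivIset M.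

Definition is_perfect_matching (T : finType) (e : rel T)
    (M : {set {set T}}) : bool :=
  is_matching e M && (cover M == [set: T]).

Definition matching_number (T : finType) (e : rel T) : nat :=
  \max_(M : {set {set T}} | is_matching e M) #|M|.

(* Counting ordered pairs (x, y) counts an edge once in general, and twice
   when both of its ends lie in X :&: Y. *)
Definition edges_between (T : finType) (e : rel T) (X Y : {set T}) : nat :=
  #|[set p in setX X Y | e p.1 p.2]|.

Definition is_complete (T : finType) (e : rel T) : Prop :=
  forall x y : T, x != y -> e x y.

(* Complete graphs are (n, beta)-graphs by convention: taking X = Y = [set v]
   shows that for small beta they do not satisfy the ratio condition. *)
Definition nbeta_graph (R : realType) (n : nat) (beta : R)
    (T : finType) (e : rel T) : Prop :=
  #|T| = n /\
  (is_complete e \/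
   forall X Y : {set T},
     X \proper [set: T] -> Y \proper [set: T] ->
     edges_between e X Y = 0%N ->
     (#|X|%:R * #|Y|%:R) / ((n%:R - #|X|%:R) * (n%:R - #|Y|%:R))
       <= beta ^+ 2).

(* Main.v *)
(* By Tutte-Berge there is a set [S] of [s] vertices such that [G - S] has [m]
   vertices, falls into [q] pairwise non-adjacent classes, and
   [2 alpha' >= n + s - q].  If [q <= s + 1] then [2 alpha' >= n - 1].
   Otherwise beta is bounded below in terms of [s], [m], [q].  If [m <= 2 q],
   take for [X = Y] one vertex in each class.  If [m >= 2 q], the classes can be
   split into two unions [X] and [Y] of at least [q - 1] vertices each, and this
   much balance already suffices.  Both choices give
   [m + q - 2 <= beta (2 m - q - 1 + 3 s)], which is a rearrangement of the
   claimed bound on [q - s]. *)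
Require Import Defs.
From mathcomp Require Import all_boot all_order all_algebra.
From mathcomp Require Import reals.
From mathcomp Require Import ring lra zify.

Import Order.TTheory GRing.Theory Num.Theory.

(** * Splitting a weighted set into two nearly equal halves *)

(* A part of weight 1 is removed together with one unit of a part of weight at
   least 3; once every weight is at least 2, any even split of the parts works. *)
Lemma balanced_split (I : finType) (Q : {set I}) (w : I -> nat) :
  (forall i, i \in Q -> 0 < w i) -> #|Q|.*2 <= \sum_(i in Q) w i ->
  exists2 A : {set I}, A \subset Q &
    #|Q| <= (\sum_(i in A) w i).+1 /\ #|Q| <= (\sum_(i in Q :\: A) w i).+1.
Proof.
have [k] := ubnP #|Q|; elim: k => // k IHk in Q w *; rewrite ltnS => leQk w0 hw.
have [/existsP[i /andP[iQ /eqP wi]]|no1] := boolP [exists i in Q, w i == 1].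
  have [/existsP[j /andP[jQ wj]]|no3] := boolP [exists j in Q, 2 < w j]; last first.
    (* Without a weight above 2, the total would be at most [1 + 2 * (#|Q| - 1)], which is too
       small. *)
    exfalso; move: hw; rewrite (bigD1 i) //= wi (cardsD1 i Q) iQ.
    have : \sum_(j in Q | j != i) w j <= \sum_(j in Q | j != i) 2.
      apply: leq_sum => j /andP[jQ _]; rewrite leqNgt.
      by move: no3; rewrite negb_exists => /forallP/(_ j); rewrite jQ.
    rewrite sum_nat_const.
    have -> : #|[pred j | (j \in Q) && (j != i)]| = #|Q :\ i|.
      by apply: eq_card => j; rewrite !inE andbC.
    lia.
  have ji : j != i by apply: contraTneq wj => ->; rewrite wi.
  (* One part fewer and total weight two less: the hypothesis on the total survives. *)
  pose Q' := Q :\ i; pose w' l := if l == j then (w j).-1 else w l.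
  have jQ' : j \in Q' by rewrite !inE ji.
  have cQ : #|Q| = #|Q'|.+1 by rewrite (cardsD1 i Q) iQ.
  have sumw (B : {set I}) : \sum_(l in B) w l = \sum_(l in B) w' l + (j \in B).
    have [jB|jB] := boolP (j \in B).
      rewrite [LHS](bigD1 j) // [in RHS](bigD1 j) //= [w' j]/w' eqxx.
      have -> : \sum_(l in B | l != j) w' l = \sum_(l in B | l != j) w l.
        by apply: eq_bigr => l /andP[_ /negPf lj]; rewrite /w' lj.
      lia.
    rewrite addn0; apply: eq_bigr => l lB; rewrite /w' ifN //.
    by apply: contraNneq jB => <-.
  have sumi (B : {set I}) : i \notin B -> \sum_(l in i |: B) w l = (\sum_(l in B) w l).+1.
    by move=> iB; rewrite big_setU1 //= wi.
  have sQ : \sum_(l in Q) w l = (\sum_(l in Q') w l).+1.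
    by rewrite -sumi ?setD1K // !inE eqxx.
  have [| | |A AQ' [h1 h2]] := IHk Q' w'.
  - by rewrite -ltnS -cQ.
  - move=> l; rewrite !inE /w' => /andP[_ lQ]; case: eqP => _; last exact: w0.
    lia.
  - by move: hw; rewrite sQ sumw jQ'; lia.
  have iA : i \notin A by apply: contraTN isT => /(subsetP AQ'); rewrite !inE eqxx.
  have AQ : A \subset Q by apply: subset_trans AQ' (subD1set _ _).
  (* The side holding [j] gets its unit back and [i] joins the other side, so each side gains
     one. *)
  have [jA|jA] := boolP (j \in A).
    exists A => //.
    have -> : Q :\: A = i |: (Q' :\: A).
      apply/setP=> l; rewrite !inE; case: (eqVneq l i) => [->|] //=.
      by rewrite iA iQ.
    rewrite sumi ?inE ?eqxx ?andbF // !sumw jA; lia.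
  exists (i |: A); first by rewrite subUset sub1set iQ.
  have -> : Q :\: (i |: A) = Q' :\: A.
    by apply/setP=> l; rewrite !inE negb_or -andbA andbCA andbA.
  rewrite sumi // !sumw !inE jA ji jQ /=; lia.
have w2 i : i \in Q -> 1 < w i.
  move=> iQ; move: no1; rewrite negb_exists => /forallP/(_ i).
  by rewrite iQ /=; have := w0 i iQ; lia.
have sum2 (B : {set I}) : B \subset Q -> #|B|.*2 <= \sum_(i in B) w i.
  move=> BQ; rewrite -muln2 -sum_nat_const; apply: leq_sum => i iB.
  exact/w2/(subsetP BQ).
(* Each side gets at least [#|Q|./2] parts of weight at least 2, hence weight at least
   [#|Q| - 1]. *)
have [s [us ss sQ]] : exists s : seq I, [/\ uniq s, size s = #|Q|./2 & {subset s <= Q}].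
  exists (take #|Q|./2 (enum Q)); split.
  - exact/take_uniq/enum_uniq.
  - by rewrite size_takel // -cardE; lia.
  - by move=> i /mem_take; rewrite mem_enum.
have sub : [set i in s] \subset Q by apply/subsetP => i; rewrite inE => /sQ.
have cs : #|[set i in s]| = #|Q|./2 by rewrite cardsE (card_uniqP us).
exists [set i in s] => //.
have := sum2 _ sub; have := sum2 _ (subsetDl Q [set i in s]).
have := cardsID [set i in s] Q; rewrite (setIidPr sub) cs; lia.
Qed.

(** * Matchings, Gallai's exchange and the Tutte-Berge formula *)

Section Matchings.
Variables (T : finType) (e : rel T).
Hypotheses (e_sym : symmetric e) (e_irr : irreflexive e).
Implicit Types (M N : {set {set T}}) (W S : {set T}).

Lemma edge_setP (B : {set T}) :
  reflect (exists x y, e x y /\ B = [set x; y]) (B \in edge_set e).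
Proof.
apply: (iffP imsetP) => [[[x y]]|[x [y [exy ->]]]]; first by rewrite inE => exy ->; exists x, y.
by exists (x, y); rewrite ?inE.
Qed.

Lemma edge_at (B : {set T}) x :
  B \in edge_set e -> x \in B -> exists2 y, e x y & B = [set x; y].
Proof.
case/edge_setP=> a [b [eab ->]]; rewrite !inE => /orP[]/eqP->; first by exists b.
by exists a; rewrite 1?e_sym // setUC.
Qed.

Lemma card_edge (B : {set T}) : B \in edge_set e -> #|B| = 2.
Proof.
case/edge_setP=> a [b [eab ->]]; rewrite cards2.
by have -> : a != b by apply: contraTneq eab => ->; rewrite e_irr.
Qed.

Lemma card_cover_matching M : is_matching e M -> #|cover M| = #|M|.*2.
Proof.
case/andP=> /subsetP sM /eqP <-; rewrite -muln2 -sum_nat_const.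
by apply: eq_bigr => B /sM/card_edge.
Qed.

Lemma cover_setU1 (B : {set T}) M : cover (B |: M) = B :|: cover M.
Proof. by rewrite /cover bigcup_setU big_set1. Qed.

Lemma matchingS M N : M \subset N -> is_matching e N -> is_matching e M.
Proof.
by move=> MN /andP[sN tN]; rewrite /is_matching (subset_trans MN) // (trivIsetS MN).
Qed.

Lemma matching_add M x y :
  is_matching e M -> e x y -> x \notin cover M -> y \notin cover M ->
  is_matching e ([set x; y] |: M) /\ #|[set x; y] |: M| = #|M|.+1.
Proof.
move=> /andP[sM tM] exy xM yM.
have exM : [set x; y] \notin M.
  by apply: contra xM => B; apply/bigcupP; exists [set x; y]; rewrite // !inE eqxx.
split; last by rewrite cardsU1 exM.
rewrite /is_matching subUset sub1set sM andbT; apply/andP; split.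
  by apply/edge_setP; exists x, y.
have dis B : B \in M -> [disjoint [set x; y] & B].
  move=> BM; rewrite disjoints_subset; apply/subsetP => z; rewrite !inE => /orP[]/eqP->.
    by apply: contra xM => xB; apply/bigcupP; exists B.
  by apply: contra yM => xB; apply/bigcupP; exists B.
apply/trivIsetP => A B; rewrite !inE => /orP[/eqP->|AM] /orP[/eqP->|BM] AB.
- by rewrite eqxx in AB.
- exact: dis.
- by rewrite disjoint_sym; exact: dis.
- exact: (trivIsetP tM).
Qed.

Lemma cover_setD1 (B : {set T}) M :
  is_matching e M -> B \in M -> cover (M :\ B) = cover M :\: B.
Proof.
move=> /andP[_ tM] BM; apply/setP => z; rewrite !inE.
apply/bigcupP/andP => [[C]|[zB /bigcupP[C CM zC]]].
  rewrite !inE => /andP[CB CM] zC; split; last by apply/bigcupP; exists C.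
  by have /pred0P/(_ z) /= := trivIsetP tM _ _ CM BM CB; rewrite zC /= => ->.
by exists C => //; rewrite !inE CM andbT; apply: contraNneq zB => <-.
Qed.

(** The matching number of the subgraph induced on [W], expressed through matchings of the whole
    graph. *)
Definition nu W :=
  \max_(M : {set {set T}} | is_matching e M && (cover M \subset W)) #|M|.

Definition maximum_in W M :=
  [&& is_matching e M, cover M \subset W & #|M| == nu W].

Lemma leq_nu W M : is_matching e M -> cover M \subset W -> #|M| <= nu W.
Proof.
move=> mM cM; rewrite /nu.
by rewrite (bigD1 M) ?mM //= leq_maxl.
Qed.

Lemma maximum_exists W : exists M, maximum_in W M.
Proof.
have h0 : is_matching e set0 && (cover set0 \subset W).
  rewrite /is_matching sub0set /cover big_set0 sub0set andbT.
  by apply/trivIsetP => A B; rewrite inE.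
case: (@arg_maxnP _ set0 (fun M => is_matching e M && (cover M \subset W))
        (fun M => #|M|) h0) => M /andP[mM cM] Mmax.
exists M; rewrite /maximum_in mM cM eqn_leq leq_nu //=.
by apply/bigmax_leqP => N; apply: Mmax.
Qed.

Lemma maximum_edge W M x y : maximum_in W M -> x \in W -> y \in W -> e x y ->
  x \notin cover M -> y \in cover M.
Proof.
case/and3P=> mM cM /eqP sM xW yW exy xM; apply: contraT => yM.
have [mN sN] := matching_add _ _ _ mM exy xM yM.
suff : #|[set x; y] |: M| <= nu W by rewrite sN sM ltnn.
by apply: leq_nu mN _; rewrite cover_setU1 !subUset !sub1set xW yW.
Qed.

(* Gallai's exchange argument: among the maximum matchings missing [w], one
   sharing the most edges with [M] can still be moved closer to [M]. *)
Lemma gallai_exchange W M u v w : maximum_in W M ->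
  u != v -> u \notin cover M -> v \notin cover M ->
  (exists2 N, maximum_in W N & w \notin cover N) ->
  exists2 N, maximum_in W N &
    (w \notin cover N) && ((u \notin cover N) || (v \notin cover N)).
Proof.
move=> mM uv uM vM [N0 mN0 wN0].
have [//|none] :=
  boolP [exists N, maximum_in W N &&
           ((w \notin cover N) && ((u \notin cover N) || (v \notin cover N)))].
  by case/existsP=> N /andP[]; exists N.
have cov N : maximum_in W N -> w \notin cover N -> (u \in cover N) /\ (v \in cover N).
  move=> mN wN; move: none; rewrite negb_exists => /forallP/(_ N).
  by rewrite mN wN /= negb_or !negbK => /andP[].
exfalso.
have P0 : maximum_in W N0 && (w \notin cover N0) by rewrite mN0.
case: (@arg_maxnP _ N0 (fun N => maximum_in W N && (w \notin cover N))
        (fun N => #|M :&: N|) P0) => N /andP[mN wN] Nmax.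
have [uN vN] := cov N mN wN.
have [/and3P[mM1 mM2 /eqP mM3] /and3P[mN1 mN2 /eqP mN3]] := (mM, mN).
have cMN : #|cover M| = #|cover N|.
  by rewrite !card_cover_matching // mM3 mN3.
(* [M] and [N] cover equally many vertices, and [N] covers [u] and [v], which [M] misses. So [M]
   covers at least two vertices missed by [N], one of them other than [w]. *)
have [x xM [xw xN]] : exists2 x, x \in cover M & (x != w) /\ (x \notin cover N).
  have : 1 < #|cover M :\: cover N|.
    have : [set u; v] \subset cover N :\: cover M.
      by apply/subsetP => z; rewrite !inE => /orP[]/eqP->; rewrite ?uM ?vM.
    by move/subset_leq_card; rewrite cards2 uv cardsD -cMN setIC -cardsD.
  rewrite (cardsD1 w) => h.
  have : 0 < #|(cover M :\: cover N) :\ w|.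
    by move: h; case: (w \in _) => //; apply: ltn_trans.
  by case/card_gt0P=> x; rewrite !inE => /and3P[h1 h2 h3]; exists x.
have [B0 B0M xB0] := bigcupP xM.
have [sM tM] := andP mM1; have [sN tN] := andP mN1.
have [y exy B0E] := edge_at _ _ (subsetP sM _ B0M) xB0.
have yB0 : y \in B0 by rewrite B0E !inE eqxx orbT.
have yM : y \in cover M by apply/bigcupP; exists B0.
have yN : y \in cover N.
  by apply: (maximum_edge _ _ _ _ mN _ _ exy xN); apply: (subsetP mM2).
have [B1 B1N yB1] := bigcupP yN.
have B0N : B0 \notin N by apply: contra xN => B0N; apply/bigcupP; exists B0.
have B1M : B1 \notin M.
  apply: contra B0N => B1M; suff -> : B0 = B1 by [].
  apply: contraTeq yB1 => B01.
  by have /pred0P/(_ y) /= := trivIsetP tM _ _ B0M B1M B01; rewrite yB0 /= => ->.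
(* Trading [B1] for [B0] in [N] keeps the size, still misses [w] and gains an edge of [M], against
   the choice of [N]. *)
have cD := cover_setD1 _ _ mN1 B1N.
have mD : is_matching e (N :\ B1) by apply: matchingS mN1; apply: subD1set.
have xD : x \notin cover (N :\ B1) by rewrite cD !inE (negPf xN) andbF.
have yD : y \notin cover (N :\ B1) by rewrite cD !inE yB1.
have [mN' sN'] := matching_add _ _ _ mD exy xD yD.
rewrite -B0E in mN' sN'.
have N'P : maximum_in W (B0 |: N :\ B1) && (w \notin cover (B0 |: N :\ B1)).
  rewrite /maximum_in mN' sN' cover_setU1 cD subUset -mN3 (cardsD1 B1 N) B1N eqxx.
  rewrite (subset_trans (subsetDl _ _) mN2) !andbT andTb; apply/andP; split.
    by apply: subset_trans mM2; apply/subsetP => z zB; apply/bigcupP; exists B0.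
  rewrite !inE (negPf wN) andbF orbF B0E !inE negb_or eq_sym xw /=.
  by apply: contraNneq wN => ->.
have := Nmax _ N'P; apply/negP; rewrite -ltnNge.
have : B0 |: (M :&: N) \subset M :&: (B0 |: N :\ B1).
  rewrite subUset sub1set !inE B0M eqxx /=; apply/subsetP => B; rewrite !inE.
  by case/andP=> BM BN; rewrite BM BN !andbT; apply/orP; right; apply: contraNneq B1M => <-.
by move/subset_leq_card; rewrite cardsU1 !inE (negPf B0N) andbF.
Qed.

(* The part of the Tutte-Berge formula needed here: [f] labels the vertices
   outside [S] by unions of components of [G - S].  Choosing [S] largest with
   [nu (G - S) + |S| <= nu G], every vertex of [G - S] is missed by a maximum
   matching of [G - S]; Gallai's exchange then makes "no maximum matching misses
   both vertices" an equivalence, whose classes are the labels. *)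
Lemma tutte_berge :
  exists (S : {set T}) (f : T -> T),
    (forall x y, x \notin S -> y \notin S -> e x y -> f x = f y) /\
    #|T| + #|S| <= (matching_number e).*2 + #|f @: ~: S|.
Proof.
have nuT : nu [set: T] = matching_number e.
  by apply: eq_bigl => M; rewrite subsetT andbT.
have P0 : #|set0 : {set T}| + nu (~: set0) <= matching_number e.
  by rewrite cards0 setC0 nuT.
case: (@arg_maxnP _ set0 (fun S : {set T} => #|S| + nu (~: S) <= matching_number e)
  (fun S => #|S|) P0) => S PS Smax; set W := ~: S in PS *.
(* If every maximum matching inside [W] covered [w], moving [w] into [S] would lower [nu] and
   contradict the maximality of [S]. *)
have miss w : w \in W -> exists2 M, maximum_in W M & w \notin cover M.
  move=> wW; have [M /and3P[mM cM /eqP sM]] := maximum_exists (W :\ w).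
  exists M; last by apply: contraTN isT => /(subsetP cM); rewrite !inE eqxx.
  rewrite /maximum_in mM (subset_trans cM (subD1set _ _)) /= eqn_leq leq_nu //=; last first.
    exact: (subset_trans cM (subD1set _ _)).
  have wS : w \notin S by rewrite !inE in wW.
  rewrite leqNgt; apply/negP => lt.
  have := Smax (w |: S); rewrite cardsU1 wS setCU -/W setIC -setDE -sM => H.
  suff : 1 + #|S| <= #|S| by rewrite ltnn.
  by apply: H; apply: leq_trans PS; rewrite add1n addSnnS leq_add2l.
pose r x y := [forall M, maximum_in W M ==> (x == y) || (x \in cover M) || (y \in cover M)].
have rP x y : reflect
    (forall M, maximum_in W M -> x != y -> x \notin cover M -> y \in cover M) (r x y).
  apply: (iffP forallP) => H M; have := H M.
    by move=> /implyP h /h; case: (x == y); case: (x \in cover M).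
  by move=> h; apply/implyP=> /h; case: (x == y); case: (x \in cover M) => //=; apply.
have rsym x y : r x y = r y x.
  by apply: eq_forallb => M; rewrite eq_sym -!orbA [(x \in _) || _]orbC.
have rtrans u v w : w \in W -> r u w -> r w v -> r u v.
  move=> wW /rP uw /rP wv; apply/rP => M mM uv uM; apply: contraT => vM.
  have [N mN /andP[wN /orP[uN|vN]]] := gallai_exchange _ _ _ _ _ mM uv uM vM (miss w wW).
    have [uw_|nuw] := eqVneq u w; last by have := uw N mN nuw uN; rewrite (negPf wN).
    by rewrite (wv M mM) // -?uw_ in vM.
  have [wv_|nwv] := eqVneq w v; last by have := wv N mN nwv wN; rewrite (negPf vN).
  by rewrite -wv_ (uw M mM) // wv_ in vM.
(* A canonical representative of the class of [x]. For [x] in [W] the default is never reached,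
   since [x] itself qualifies. *)
pose f x := odflt x [pick y in W | r x y].
exists S, f; split.
  move=> x y; rewrite -[x \in S]negbK -[y \in S]negbK !negbK -!in_setC -/W => xW yW exy.
  have rxy : r x y by apply/rP => M mM _; apply: maximum_edge mM xW yW exy.
  rewrite /f.
  have E : [pred z | (z \in W) && r x z] =1 [pred z | (z \in W) && r y z].
    move=> z /=; case: (z \in W) => //=; apply/idP/idP; apply: rtrans => //.
    by rewrite rsym.
  rewrite (eq_pick E); case: pickP => //= /(_ x); rewrite /= xW rsym rxy //.
have [M mM] := maximum_exists W; have [mM1 mM2 /eqP mM3] := and3P mM.
(* Vertices missed by [M] lie in different classes, so there are at least [#|W| - 2 * nu W]
   labels. *)
have inj : {in W :\: cover M &, injective f}.
  move=> x y; rewrite !inE => /andP[xM xW] /andP[yM yW]; rewrite /f.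
  have rxx z : r z z by apply/rP => ? ?; rewrite eqxx.
  case: pickP => [x' /andP[x'W rx]|/(_ x)]; last by rewrite !inE xW rxx.
  case: pickP => [y' /andP[y'W ry]|/(_ y)]; last by rewrite !inE yW rxx.
  move=> /= xy; rewrite -xy in ry; apply: contraTeq yM => nxy; rewrite negbK.
  have /rP h : r x y by apply: rtrans x'W rx _; rewrite rsym.
  exact: h.
have : #|f @: (W :\: cover M)| <= #|f @: W| by apply/subset_leq_card/imsetS/subsetDl.
rewrite card_in_imset //.
have := cardsID (cover M) W; rewrite (setIidPr mM2) card_cover_matching // mM3.
have := cardsC S; rewrite -/W; lia.
Qed.

End Matchings.

(** * Real inequalities for the two choices of [X] and [Y] *)

Local Open Scope ring_scope.

(** For [X = Y] independent of size [q] in a graph on [s + m] vertices: the last hypothesis is the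
    square root of the ratio condition. *)
Lemma transversal_ineq (R : realFieldType) (beta s m q : R) :
  0 <= s -> s + 2 <= q -> q <= m -> m <= 2 * q -> q < s + m ->
  q <= beta * (s + m - q) ->
  m + q - 2 <= beta * (2 * m - q - 1 + 3 * s).
Proof.
move=> s0 sq qm m2q qn hb.
have D0 : 0 < s + m - q by lra.
rewrite -(ler_pM2l D0); apply: (@le_trans _ _ (q * (2 * m - q - 1 + 3 * s))).
  rewrite -subr_ge0.
  have -> : q * (2 * m - q - 1 + 3 * s) - (s + m - q) * (m + q - 2) =
    (2 * q - m) * (s + m - 3 / 2) + (s + m) * 2 - m * 3 / 2 by field.
  have : 0 <= (2 * q - m) * (s + m - 3 / 2) by apply: mulr_ge0; lra.
  lra.
rewrite mulrA [(s + m - q) * beta]mulrC; apply: ler_wpM2r => //; lra.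
Qed.

(** Here [x] and [y] are the sizes of [X] and [Y], so that [s + x = n - y] and [s + y = n - x]. *)
Lemma split_ineq (R : realFieldType) (beta s m q x y : R) :
  0 < beta -> 0 <= s -> s + 2 <= q -> 2 * q <= m ->
  x + y = m -> q - 1 <= x -> q - 1 <= y ->
  x * y <= beta ^+ 2 * ((s + x) * (s + y)) ->
  m + q - 2 <= beta * (2 * m - q - 1 + 3 * s).
Proof.
move=> b0 s0 sq q2m xym qx qy hb.
(* With [x + y] fixed, the product is least when one factor is [q - 1]. *)
have hP : (q - 1) * (m - q + 1) <= x * y.
  have : 0 <= (x - (q - 1)) * (y - (q - 1)) by apply: mulr_ge0; lra.
  rewrite -xym; lra.
have x0 : 0 < x by lra.
have y0 : 0 < y by lra.
have P0 : 0 < x * y by apply: mulr_gt0.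
have sm0 : 0 <= s * m by apply: mulr_ge0; lra.
(* AM-GM, in the form [sqrt ((1 + s / x) (1 + s / y)) <= 1 + s m / (2 x y)] *)
have hb' : 2 * (x * y) <= beta * (2 * (x * y) + s * m).
  rewrite -ler_sqr ?nnegrE; try by [lra | apply: mulr_ge0; lra].
  rewrite exprMn.
  have h1 : 4 * (x * y) * (x * y) <=
            4 * (x * y) * (beta ^+ 2 * ((s + x) * (s + y))).
    by apply: ler_wpM2l => //; lra.
  (* This is the exact gap, since [(2xy + sm)^2 - 4xy(s + x)(s + y) = (s(x - y))^2]. *)
  have h2 : 0 <= beta ^+ 2 * (s * (x - y)) ^+ 2.
    by apply: mulr_ge0; apply: sqr_ge0.
  rewrite -xym; nra.
(* The difference of the two sides is affine in [s]; this is [s = q - 2]. *)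
have hend : (m + q - 2) * (q - 2) * m <= 2 * (x * y) * (m + q - 5).
  apply: (@le_trans _ _ (2 * ((q - 1) * (m - q + 1)) * (m + q - 5))).
    (* In [p = q - 2] and [u = m - 2 * q], the difference of the sides has only nonnegative
       coefficients. *)
    have [u u0 ->] : exists2 u, 0 <= u & m = 2 * q + u by exists (m - 2 * q); lra.
    have [p p0 ->] : exists2 p, 0 <= p & q = p + 2 by exists (q - 2); lra.
    have pu := mulr_ge0 p0 u0; have pp := mulr_ge0 p0 p0; have uu := mulr_ge0 u0 u0.
    have ppu := mulr_ge0 p0 pu; have ppp := mulr_ge0 p0 pp; have puu := mulr_ge0 pu u0.
    lra.
  by apply: ler_wpM2r; lra.
have key : (m + q - 2) * (2 * (x * y) + s * m) <=
           2 * (x * y) * (2 * m - q - 1 + 3 * s).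
  case: (ltrP 2 q) => q2; last first.
    have -> : s = 0 by lra.
    rewrite mul0r mulr0 !addr0 mulrC; apply: ler_wpM2l; lra.
  (* Interpolation between [s = 0] and [s = q - 2], with weights [q - 2 - s] and [s]. *)
  rewrite -(ler_pM2l (_ : 0 < q - 2)); last by lra.
  have h3 : 0 <= s * (2 * (x * y) * (m + q - 5) - (m + q - 2) * (q - 2) * m).
    by apply: mulr_ge0; lra.
  have h4 : 0 <= (q - 2 - s) * (x * y * (m + 1 - 2 * q)).
    by apply: mulr_ge0; [lra | apply: mulr_ge0; lra].
  lra.
have E0 : 0 < 2 * (x * y) + s * m by lra.
rewrite -(ler_pM2r E0); apply: le_trans key _.
rewrite [leRHS]mulrAC; apply: ler_wpM2r => //; lra.
Qed.

(** * From the ratio condition to a bound on the number of classes *)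

Section NBeta.
Variables (R : realType) (T : finType) (e : rel T).
Hypothesis e_irr : irreflexive e.

Lemma nbeta_ratio (n : nat) (beta : R) (X Y : {set T}) :
  nbeta_graph n beta e -> ~ is_complete e -> (#|X| < n)%N -> (#|Y| < n)%N ->
  (forall x y, x \in X -> y \in Y -> ~~ e x y) ->
  #|X|%:R * #|Y|%:R <= beta ^+ 2 * ((n%:R - #|X|%:R) * (n%:R - #|Y|%:R)).
Proof.
move=> [Tn [//|hG]] _ Xn Yn noe.
have pT (Z : {set T}) : (#|Z| < n)%N -> Z \proper [set: T].
  by move=> Zn; rewrite properEcard subsetT cardsT Tn.
have e0 : edges_between e X Y = 0%N.
  apply/eqP; rewrite cards_eq0; apply/eqP/setP => -[x y]; rewrite !inE /=.
  by apply/negP => /andP[/andP[xX yY]]; apply/negP/noe.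
have := hG X Y (pT X Xn) (pT Y Yn) e0; rewrite ler_pdivrMr //.
by apply: mulr_gt0; rewrite subr_gt0 ltr_nat.
Qed.

Lemma sum_card_fibers (W A : {set T}) (f : T -> T) :
  (\sum_(i in A) #|[set x in W | f x == i]| = #|[set x in W | f x \in A]|)%N.
Proof.
rewrite -sum1_card [RHS](partition_big f (mem A)) /=; last by move=> x; rewrite inE => /andP[].
apply: eq_bigr => i iA; rewrite -sum1_card; apply: eq_bigl => x; rewrite !inE.
by case: eqP => [->|_]; rewrite ?andbF // iA !andbT.
Qed.

(* With [d = q - s] and [s + m = n], this says [(1 + beta) (d - 1) <= (2 beta - 1) (n - 1)]. *)
Lemma classes_bound (n : nat) (beta : R) (S : {set T}) (f : T -> T) :
  0 < beta -> nbeta_graph n beta e -> (n = 2%N -> exists x y : T, e x y) ->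
  (forall x y, x \notin S -> y \notin S -> e x y -> f x = f y) ->
  (#|S| + 2 <= #|f @: ~: S|)%N ->
  #|~: S|%:R + #|f @: ~: S|%:R - 2 <=
    beta * (2 * #|~: S|%:R - #|f @: ~: S|%:R - 1 + 3 * #|S|%:R).
Proof.
move=> b0 G not2K1 fe; set W := ~: S => sq.
set s := #|S|%:R; set m := #|W|%:R; set q := #|f @: W|%:R.
have feW x y : x \in W -> y \in W -> e x y -> f x = f y.
  by rewrite !inE; apply: fe.
have qm : (#|f @: W| <= #|W|)%N by apply: leq_imset_card.
have nT : (#|S| + #|W|)%N = n by rewrite cardsC; case: G.
have nR : n%:R = s + m by rewrite -nT natrD.
have s0 : 0 <= s by apply: ler0n.
have sqR : s + 2 <= q by rewrite -natrD ler_nat.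
have qmR : q <= m by rewrite ler_nat.
have ncomp : ~ is_complete e.
  move=> comp; have : (1 < #|f @: W|)%N by lia.
  case/card_gt1P=> _ [_ [/imsetP[x xW ->] /imsetP[y yW ->] nxy]].
  have xy : x != y by apply: contraNneq nxy => ->.
  by rewrite (feW x y) ?eqxx ?comp in nxy.
have ratio := nbeta_ratio n beta _ _ G ncomp.
have [q2m|m2q] := leqP (#|f @: W|.*2) #|W|.
  (* The weights are the class sizes; no edge joins two classes, so the two sides of a split form an
     admissible pair. *)
  pose w i := #|[set x in W | f x == i]|.
  have w0 i : i \in f @: W -> (0 < w i)%N.
    by case/imsetP=> x xW ->; apply/card_gt0P; exists x; rewrite inE xW /=.
  have wW : (\sum_(i in f @: W) w i)%N = #|W|.
    rewrite sum_card_fibers; apply: eq_card => x; rewrite inE.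
    by case: (boolP (x \in W)) => // xW; rewrite imset_f.
  have [|A AQ []] := balanced_split _ _ w w0; first by rewrite wW.
  rewrite !sum_card_fibers.
  set X := [set x in W | _]; set Y := [set x in W | _] => qX qY.
  have XY : (#|X| + #|Y|)%N = #|W|.
    rewrite -wW (big_setID A) /= (setIidPr AQ); congr (_ + _)%N.
      by rewrite sum_card_fibers.
    by rewrite sum_card_fibers.
  have XYR : #|X|%:R + #|Y|%:R = m by rewrite -natrD XY.
  have qle k : (#|f @: W| <= k.+1)%N -> q - 1 <= k%:R.
    by rewrite lerBlDr natr1 ler_nat.
  apply: (split_ineq _ _ _ _ _ #|X|%:R #|Y|%:R) => //.
  - by rewrite -natrM ler_nat mul2n.
  - exact: qle.
  - exact: qle.
  have -> : s + #|X|%:R = n%:R - #|Y|%:R by rewrite nR; lra.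
  have -> : s + #|Y|%:R = n%:R - #|X|%:R by rewrite nR; lra.
  rewrite [X in _ ^+ 2 * X]mulrC; apply: ratio; [lia | lia |].
  move=> x y; rewrite !inE => /andP[xW fx] /andP[yW /andP[fy _]].
  by apply: contra fy => exy; rewrite -(feW x y) ?inE.
have [I [IW cI noe]] : exists I : {set T},
    [/\ I \subset W, #|I| = #|f @: W| & forall x y, x \in I -> y \in I -> ~~ e x y].
  pose g i := odflt i [pick x in W | f x == i].
  have gP i : i \in f @: W -> g i \in W /\ f (g i) = i.
    case/imsetP=> z zW ->; rewrite /g; case: pickP => [x /andP[xW /eqP]|/(_ z)] //.
    by rewrite zW eqxx.
  exists (g @: (f @: W)); split.
  - by apply/subsetP => _ /imsetP[i iQ ->]; case: (gP i iQ).
  - apply: card_in_imset => i j iQ jQ gij.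
    by rewrite -(gP i iQ).2 -(gP j jQ).2 gij.
  - move=> _ _ /imsetP[i iQ ->] /imsetP[j jQ ->]; apply/negP => eij.
    have [[iW fi] [jW fj]] := (gP i iQ, gP j jQ).
    by move: (feW _ _ iW jW eij); rewrite fi fj => ij; rewrite ij e_irr in eij.
have [qn|] := ltnP #|f @: W| n.
  have qnR : q < s + m by rewrite -nR ltr_nat.
  apply: transversal_ineq => //; first by rewrite -natrM ler_nat mul2n ltnW.
  have D0 : 0 < s + m - q by lra.
  have := ratio I I; rewrite cI nR => /(_ qn qn noe) h.
  rewrite -ler_sqr ?nnegrE ?ler0n //; last by apply: mulr_ge0; lra.
  by rewrite exprMn !expr2 in h *.
(* The graph has no edges, so that a proper independent set omits a vertex. *)
rewrite -nT => nq; have S0 : #|S| = 0%N by lia.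
have Wn : #|W| = n by lia.
have qn : #|f @: W| = n by lia.
have IT : I = [set: T].
  by apply/eqP; rewrite eqEcard subsetT cardsT cI qn G.1 leqnn.
(* [s + 2 <= q] gives [n >= 2], and [n = 2] would require an edge. *)
have n3 : (3 <= n)%N.
  have n2 : n <> 2%N; last by lia.
  move=> /not2K1[x [y exy]].
  by have := noe x y; rewrite IT !inE exy => /(_ isT isT).
have [x0 _] : exists x0, x0 \in W by apply/card_gt0P; lia.
(* For the [n - 1] vertices other than [x0] the ratio condition reads [(n - 1)^2 <= beta^2], so
   [beta >= n - 1 >= 2]. The goal becomes [2 * (n - 1) <= beta * (n - 1)]. *)
have cJ : (#|I :\ x0|).+1 = n by rewrite -qn -cI (cardsD1 x0 I) IT inE.
have h : #|I :\ x0|%:R * #|I :\ x0|%:R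
         <= beta ^+ 2 * ((n%:R - #|I :\ x0|%:R) * (n%:R - #|I :\ x0|%:R)).
  apply: ratio; try by rewrite -cJ.
  by move=> x y /setD1P[_ xI] /setD1P[_ yI]; apply: noe.
rewrite /s /m /q S0 qn Wn.
have k2 : 2 <= #|I :\ x0|%:R :> R by rewrite (ler_nat _ 2%N); lia.
have kn : n%:R = #|I :\ x0|%:R + 1 :> R by rewrite -cJ -natr1.
move: h k2; rewrite kn; move: (#|I :\ x0|%:R : R) => k.
have -> : k + 1 - k = 1 by lra.
rewrite !mulr1 -expr2 => h k2.
have kb : k <= beta by rewrite -ler_sqr ?nnegrE //; lra.
have : 2 * k <= beta * k by apply: ler_wpM2r; lra.
lra.
Qed.

End NBeta.

(** * The matching bound and the perfect matching *)

Theorem theorem3p4 (R : realType) (beta : R) (n : nat)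
    (T : finType) (e : rel T)
    (e_sym : symmetric e) (e_irr : irreflexive e)
    (T_nonempty : (0 < #|T|)%N)
    (* excludes only the edgeless graph on two vertices, for which the bound
       fails when 1 <= beta < 2 *)
    (not_2K1 : n = 2%N -> exists x y : T, e x y)
    (beta_gt0 : 0 < beta)
    (G_nbeta : nbeta_graph n beta e) :
  Num.min ((2 - beta) / (2 * (1 + beta))) (1 / 2) * (n%:R - 1)
    <= (matching_number e)%:R
  /\ (~~ odd n -> beta <= 1 / 2 ->
      exists M : {set {set T}}, is_perfect_matching e M).
Proof.
have Tn : #|T| = n by case: G_nbeta.
have n1 : 0 <= n%:R - 1 :> R by rewrite subr_ge0 ler1n -Tn.
have [S [f [fe]]] := tutte_berge T e e_sym e_irr; rewrite Tn => TB.
have [few|many] := leqP #|f @: ~: S| #|S|.+1.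
  have def1 : (n <= (matching_number e).*2.+1)%N by lia.
  split.
    apply: (@le_trans _ _ (1 / 2 * (n%:R - 1))).
      by apply: ler_wpM2r => //; rewrite ge_min lexx orbT.
    have : n%:R <= 2 * (matching_number e)%:R + 1 :> R.
      by rewrite -natrM natr1 ler_nat mul2n.
    lra.
  (* At most one vertex is unmatched, hence none by parity. *)
  move=> n_even _.
  have [M /and3P[mM _ /eqP cM]] := maximum_exists _ e [set: T].
  exists M; rewrite /is_perfect_matching mM /= eqEcard subsetT cardsT Tn.
  rewrite (card_cover_matching _ e e_irr) // cM.
  have -> : nu _ e [set: T] = matching_number e.
    by apply: eq_bigl => N; rewrite subsetT andbT.
  lia.
have := classes_bound _ _ _ e_irr _ _ _ _ beta_gt0 G_nbeta not_2K1 fe.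
rewrite addn2 => /(_ many) /=.
have nR : n%:R = #|S|%:R + #|~: S|%:R :> R by rewrite -natrD cardsC Tn.
have : n%:R + #|S|%:R <= 2 * (matching_number e)%:R + #|f @: ~: S|%:R :> R.
  by rewrite -natrM -!natrD ler_nat mul2n.
have : #|S|%:R + 2 <= #|f @: ~: S|%:R :> R by rewrite -natrD ler_nat addn2.
move: nR; set s := #|S|%:R; set m := #|~: S|%:R; set q := #|_ @: _|%:R.
set nu2 := (matching_number e)%:R => nR sq hnu hb; split.
  have d0 : 0 < 2 * (1 + beta) by lra.
  apply: (@le_trans _ _ ((2 - beta) / (2 * (1 + beta)) * (n%:R - 1))).
    by apply: ler_wpM2r => //; rewrite ge_min lexx.
  rewrite mulrAC ler_pdivrMr //.
  have : (1 + beta) * (n%:R + s - q) <= (1 + beta) * (2 * nu2).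
    by apply: ler_wpM2l; lra.
  rewrite nR in hb *; lra.
move=> _ b2; suff : 1 <= 0 :> R by rewrite ler10.
(* [hb] rearranges to [(1 + beta) * (q - s - 1) <= (2 * beta - 1) * (n - 1)], whose left side is
   positive and right side is not: many classes are impossible for [beta <= 1 / 2]. *)
have h1 : 0 < (1 + beta) * (q - s - 1) by apply: mulr_gt0; lra.
have h2 : 0 <= (1 - 2 * beta) * (n%:R - 1) by apply: mulr_ge0; lra.
rewrite nR in h2; lra.
Qed.
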